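(* Let $n\ge1$ be an integer, $\beta$ a complex number, and $\mathcal P_{n-1}$ the space of complex polynomials of degree at most $n-1$. Let $A_n^\beta=\tilde U_nE^{n\beta}\tilde U_n^{-1}$. Then, as operators on $\mathcal P_{n-1}$, $$A_n^\beta=\tilde V_n^{-1}\,\tilde D\,B_{n\beta}\,\tilde D^{-1}\,\tilde V_n ,$$ where $B_{n\beta}$ is the operator $x^p\mapsto\sum_{i=0}^{p}\binom{n\beta}{p-i}x^i$ (the transpose of the Riordan array $((1+x)^{n\beta},x)$, truncated to $\mathcal P_{n-1}$).
   Context: The Euler polynomials $A_k(x)$ are defined by $\frac{A_k(x)}{(1-x)^{k+1}}=\sum_{m\ge0}m^kx^m$, and $\tilde A_k(x)=A_k(x)/x$ for $k\ge1$. Operators on $\mathcal P_{n-1}$ given on monomials $x^p$, $p=0,\dots,n-1$: $\tilde U_n x^p=\frac{1}{n!}(1-x)^{n-1-p}\tilde A_{p+1}(x)$ (invertible, with $\tilde U_n^{-1}x^p=(x-1)_p[x+1]_{n-p-1}$, where $(\varphi)_k$ and $[\varphi]_k$ are falling and rising factorials); $E^{c}$ is the shift $f(x)\mapsto f(x+c)$; $\tilde V_n x^p=(1+x)^{n-p-1}x^p$ (so $\tilde V_n^{-1}x^p=(1-x)^{n-p-1}x^p$); $\tilde Dx^p=(p+1)x^p$. $\binom{c}{k}=c(c-1)\cdots(c-k+1)/k!$ for complex $c$. *)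

(* Defs.v *)
From HB Require Import structures.
From mathcomp Require Import all_boot all_order all_algebra.
From mathcomp Require Import reals complex.
From mathcomp Require Import ring zify.

Set Implicit Arguments.
Unset Strict Implicit.
Unset Printing Implicit Defensive.

Import Order.TTheory GRing.Theory Num.Theory.
Local Open Scope ring_scope.

Section EulerPolynomials.
Variable F : fieldType.

(* The m-th coefficient of the formal power series
   (1 - x)^(k+1) * \sum_(m >= 0) m^k x^m  (Cauchy product, with 0^0 = 1). *)
Definition euler_coef (k m : nat) : F :=
  \sum_(i < m.+1) ((1 - 'X) ^+ k.+1 : {poly F})`_i * ((m - i) ^ k)%:R.

(* That series is a polynomial of degree at most k, so cutting it at degree k
   loses nothing: see coef_euler_poly. *)
Definition euler_poly (k : nat) : {poly F} :=
  \poly_(m < k.+1) euler_coef k m.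

Definition euler_tilde (k : nat) : {poly F} := euler_poly k %/ 'X.

(* The recurrence A_(k+1) = x (1 - x) A_k' + (k + 1) x A_k, used only in proofs. *)
Fixpoint euler_rec (k : nat) : {poly F} :=
  if k is k'.+1 then
    'X * (1 - 'X) * (euler_rec k')^`() + k'.+1%:R * ('X * euler_rec k')
  else 1.

Lemma size_euler_rec k : (size (euler_rec k) <= k.+1)%N.
Proof.
elim: k => [|k IHk] /=; first by rewrite size_poly1.
have s1X : size (1 - 'X : {poly F}) = 2%N.
  by rewrite -opprB size_polyN size_XsubC.
apply: leq_trans (size_polyD _ _) _; rewrite geq_max; apply/andP; split.
  have [->|nz] := eqVneq (euler_rec k) 0.
    by rewrite deriv0 mulr0 size_poly0.
  have lt_s := leq_trans (lt_size_deriv nz) IHk.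
  have le2 := size_polyMleq 'X (1 - 'X : {poly F}).
  have le3 := size_polyMleq ('X * (1 - 'X)) (euler_rec k)^`().
  rewrite s1X size_polyX in le2; apply: (leq_trans le3).
  rewrite -subn1 leq_subLR.
  by rewrite -ltnS -addnS; apply: (leq_trans (leq_add le2 lt_s)).
rewrite -polyC_natr mul_polyC.
apply: leq_trans (size_scale_leq _ _) _.
by apply: leq_trans (size_polyMleq _ _) _; rewrite size_polyX.
Qed.

Lemma coef_euler_rec_trunc k N i : (i < N)%N ->
  (euler_rec k - (1 - 'X) ^+ k.+1 * \poly_(m < N) (m ^ k)%:R)`_i = 0.
Proof.
elim: k i => [|k IHk] i ltiN.
  rewrite /= expr1 mulrBl mul1r !coefB coefXM !coef_poly ltiN coef1 expn0.
  case: i ltiN => [|i] ltiN /=; first by rewrite subr0 subrr.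
  by rewrite (ltnW ltiN) expn0 !subrr.
set S := fun k => \poly_(m < N) (m ^ k)%:R : {poly F}.
rewrite -/(S _) in IHk *; rewrite -/(S k.+1).
set d := _ - _ * S k in IHk.
have SE : S k.+1 = 'X * (S k)^`().
  apply/polyP => j; rewrite coefXM coef_deriv !coef_poly.
  case: j => [|j] /=; first by rewrite exp0n // if_same.
  by case: ifP => _; rewrite ?mul0rn // -mulrnA expnSr.
have -> : euler_rec k.+1 - (1 - 'X) ^+ k.+2 * S k.+1
          = ('X * d^`() - 'X * ('X * d^`())) + k.+1%:R * ('X * d).
  have de : ((1 - 'X : {poly F}) ^+ k.+1)^`() = - (k.+1%:R * (1 - 'X) ^+ k).
    by rewrite deriv_exp derivB derivX derivC /= mulr_natl -mulNrn sub0r mulN1r.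
  by rewrite /d /= SE derivB derivM de !exprS; ring.
have Xd j : (j < N)%N -> ('X * d^`())`_j = 0.
  rewrite coefXM; case: j => [|j] //= ltj.
  by rewrite coef_deriv IHk // mul0rn.
rewrite coefD coefB -polyC_natr coefCM Xd //.
rewrite !(coefXM (_ * _)) !(coefXM d); case: i ltiN => [|i] /= ltiN.
  by rewrite subrr mulr0 addr0.
by rewrite Xd ?IHk ?(ltnW ltiN) // mulr0 subrr addr0.
Qed.

Lemma coef_euler_rec k m : (euler_rec k)`_m = euler_coef k m.
Proof.
have := @coef_euler_rec_trunc k m.+1 m (leqnn _).
rewrite coefB => /eqP; rewrite subr_eq0 => /eqP ->; rewrite coefM.
by apply: eq_bigr => i _; rewrite coef_poly ltnS leq_subr.
Qed.

Lemma coef_euler_poly k m : (euler_poly k)`_m = euler_coef k m.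
Proof.
rewrite coef_poly; case: ltnP => // ltkm.
by rewrite -coef_euler_rec nth_default // (leq_trans (size_euler_rec k)).
Qed.

Lemma euler_polyE k : euler_poly k = euler_rec k.
Proof. by apply/polyP => m; rewrite coef_euler_poly coef_euler_rec. Qed.

Lemma euler_tildeK k : (0 < k)%N -> euler_tilde k * 'X = euler_poly k.
Proof.
case: k => // k _; rewrite /euler_tilde divpK // euler_polyE /=.
by apply: dvdp_add; [rewrite -mulrA | rewrite mulrCA]; apply: dvdp_mulIl.
Qed.

Lemma euler_tilde_at1 k : (0 < k)%N -> (euler_tilde k).[1] = k`!%:R.
Proof.
move=> k0; have := congr1 (horner^~ 1) (euler_tildeK k0).
rewrite hornerM hornerX mulr1 => ->; rewrite euler_polyE.
elim: k {k0} => [|k IHk] /=; first by rewrite hornerC.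
rewrite !(hornerD, hornerM, hornerN, hornerX, hornerC) subrr mulr0 mul0r add0r.
by rewrite -polyC_natr hornerC mul1r IHk factS natrM.
Qed.

Lemma size_euler_tilde k : (0 < k)%N -> (size (euler_tilde k) <= k)%N.
Proof.
move=> k0; rewrite size_divp ?polyX_eq0 // size_polyX leq_subLR.
by rewrite euler_polyE size_euler_rec.
Qed.

End EulerPolynomials.

Section Operators.
Variable F : fieldType.

(* {poly_n F} is the space of polynomials of degree at most n - 1; monop n g is
   the operator with x^p |-> g p for p < n.  All the g used below have
   size (g p) <= n, so npolyp truncates nothing: see monopX. *)
Definition monfun n (g : nat -> {poly F}) (f : {poly_n F}) : {poly_n F} :=
  \sum_(p < n) f`_p *: npolyp n (g p).

Definition monop n (g : nat -> {poly F}) : 'End({poly_n F}) :=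
  linfun (monfun g).

Definition Utilde n : 'End({poly_n F}) :=
  monop n (fun p =>
    (n`!%:R)^-1 *: ((1 - 'X) ^+ (n - 1 - p) * euler_tilde F p.+1)).

Definition Vtilde n : 'End({poly_n F}) :=
  monop n (fun p => (1 + 'X) ^+ (n - p - 1) * 'X^p).

Definition Dtilde n : 'End({poly_n F}) :=
  monop n (fun p => p.+1%:R *: 'X^p).

Definition gbinom (c : F) (k : nat) : F :=
  (\prod_(i < k) (c - i%:R)) / k`!%:R.

Definition Bop n (c : F) : 'End({poly_n F}) :=
  monop n (fun p => \sum_(i < p.+1) gbinom c (p - i) *: 'X^i).

Definition shiftfun n (c : F) (f : {poly_n F}) : {poly_n F} :=
  npolyp n (f \Po ('X + c%:P)).

Definition shiftop n (c : F) : 'End({poly_n F}) := linfun (shiftfun c).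

(* ^-1 on 'End(_) is total, but Utilde n is bijective in characteristic 0, so
   it is the true inverse here: see lker_Utilde and lker0_lfunVK. *)
Definition Aop n (beta : F) : 'End({poly_n F}) :=
  (Utilde n \o shiftop n (n%:R * beta) \o (Utilde n)^-1)%VF.

Fact monfun_is_linear n g : linear (@monfun n g).
Proof.
move=> a u v; rewrite /monfun scaler_sumr -big_split; apply: eq_bigr => p _ /=.
by rewrite coefD coefZ scalerDl scalerA.
Qed.
HB.instance Definition _ n g :=
  GRing.isLinear.Build F {poly_n F} {poly_n F} _ (@monfun n g)
    (@monfun_is_linear n g).

Fact shiftfun_is_linear n c : linear (@shiftfun n c).
Proof.
move=> a u v; apply/npolyP => i.
rewrite /shiftfun !(coefD, coefZ, coef_npolyp) comp_polyD comp_polyZ.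
by rewrite coefD coefZ; case: ifP => _ //; rewrite mulr0 addr0.
Qed.
HB.instance Definition _ n c :=
  GRing.isLinear.Build F {poly_n F} {poly_n F} _ (@shiftfun n c)
    (@shiftfun_is_linear n c).

Lemma monopE n (g : nat -> {poly F}) (f : {poly_n F}) :
  (forall p, (p < n)%N -> (size (g p) <= n)%N) ->
  monop n g f = \sum_(p < n) f`_p *: g p :> {poly F}.
Proof.
move=> sg; rewrite lfunE /= /monfun raddf_sum; apply: eq_bigr => p _ /=.
by rewrite npolypK ?sg.
Qed.

Lemma monopX n (g : nat -> {poly F}) (p : nat) : (p < n)%N -> (size (g p) <= n)%N ->
  monop n g (npolyp n 'X^p) = g p :> {poly F}.
Proof.
move=> ltpn sg; rewrite lfunE /= /monfun (bigD1 (Ordinal ltpn)) //= big1.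
  by rewrite addr0 coef_npolyp ltpn coefXn eqxx scale1r npolypK.
move=> i; rewrite -val_eqE /= => /negPf nip.
by rewrite coef_npolyp ltn_ord coefXn nip scale0r.
Qed.

Lemma shiftopE n c (f : {poly_n F}) :
  shiftop n c f = f \Po ('X + c%:P) :> {poly F}.
Proof.
rewrite lfunE /= npolypK //.
have [->|nz] := eqVneq (polyn f) 0; first by rewrite comp_poly0 size_poly0.
apply: leq_trans (size_comp_poly_leq _ _) _.
by rewrite size_XaddC muln1 prednK ?size_npoly // size_poly_gt0.
Qed.

Lemma triangular_free n (c : nat -> F) (k : nat -> {poly F}) :
    (forall p, (p < n)%N -> (k p)`_0 != 0) ->
    \sum_(p < n) c p *: ('X^p * k p) = 0 ->
  forall p, (p < n)%N -> c p = 0.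
Proof.
move=> k0 sum0 p; elim/ltn_ind: p => p IHp ltpn.
have := congr1 (fun q : {poly F} => q`_p) sum0; rewrite coef0 coef_sum.
rewrite (bigD1 (Ordinal ltpn)) //= big1 => [|i].
  rewrite addr0 coefZ coefXnM ltnn subnn => /eqP.
  by rewrite mulf_eq0 (negPf (k0 p ltpn)) orbF => /eqP.
rewrite -val_eqE /= coefZ coefXnM neq_ltn => /orP[ltip|->]; last by rewrite mulr0.
by rewrite IHp ?mul0r // ltn_ord.
Qed.

End Operators.

Section Bijectivity.
Variable F : numFieldType.

Lemma lker_monop n (g : nat -> {poly F}) :
    (forall p, (p < n)%N -> (size (g p) <= n)%N) ->
    (forall c : nat -> F, \sum_(p < n) c p *: g p = 0 ->
       forall p, (p < n)%N -> c p = 0) ->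
  lker (monop n g) == 0%VS.
Proof.
move=> sg free_g; rewrite -subv0; apply/subvP => f.
rewrite memv_ker memv0 => /eqP/(congr1 (@polyn _ _)); rewrite monopE //= => f0.
apply/eqP/npolyP => i; rewrite coef0; have [ltin|] := ltnP i n.
  exact: (free_g (fun p => f`_p)).
exact: big_coef_npoly.
Qed.

Lemma lker_Utilde n : lker (Utilde F n) == 0%VS.
Proof.
have n0 : n`!%:R != 0 :> F by rewrite pnatr_eq0 -lt0n fact_gt0.
apply: lker_monop => [p ltpn|c].
  apply: leq_trans (size_scale_leq _ _) _.
  apply: leq_trans (size_polyMleq _ _) _.
  have h2 := size_euler_tilde F (ltn0Sn p).
  have h1 : (size ((1 - 'X : {poly F}) ^+ (n - 1 - p)) <= (n - 1 - p).+1)%N.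
    apply: leq_trans (size_poly_exp_leq _ _) _.
    by rewrite -opprB size_polyN size_XsubC mul1n.
  rewrite -subn1 leq_subLR; apply: leq_trans (leq_add h1 h2) _; lia.
move=> /(congr1 (fun q => q \Po (1 - 'X))).
rewrite comp_poly0 raddf_sum /= (reindex_inj rev_ord_inj) /= => sum0 p ltpn.
pose k p := n`!%:R^-1 *: (euler_tilde F (n - p.+1).+1 \Po (1 - 'X)).
have -> : p = (n - (n - p.+1).+1)%N by lia.
apply: (@triangular_free F n (fun p => c (n - p.+1)%N) k); last by lia.
  move=> q ltqn; rewrite coefZ -horner_coef0 horner_comp !hornerE subr0.
  by rewrite euler_tilde_at1 // mulf_neq0 ?invr_eq0 // pnatr_eq0 -lt0n fact_gt0.
rewrite -[RHS]sum0; apply: eq_bigr => q _.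
rewrite !comp_polyZ comp_polyM rmorphXn /= comp_polyB comp_polyX comp_polyC.
rewrite subKr -scalerAr; congr (_ *: (_ *: _)); congr ('X^_ * _).
by have := ltn_ord q; lia.
Qed.

Lemma lker_Vtilde n : lker (Vtilde F n) == 0%VS.
Proof.
apply: lker_monop => [p ltpn|c sum0].
  apply: leq_trans (size_polyMleq _ _) _; rewrite size_polyXn.
  have h1 : (size ((1 + 'X : {poly F}) ^+ (n - p - 1)) <= (n - p - 1).+1)%N.
    apply: leq_trans (size_poly_exp_leq _ _) _.
    by rewrite addrC size_XaddC mul1n.
  rewrite addnS /=; apply: leq_trans (leq_add h1 (leqnn p)) _; lia.
apply: (@triangular_free F n c (fun p => (1 + 'X) ^+ (n - p - 1))).
  by move=> q _; rewrite -horner_coef0 !hornerE ?addr0 ?expr1n oner_eq0.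
by rewrite -[RHS]sum0; apply: eq_bigr => q _; rewrite mulrC.
Qed.

Lemma lker_Dtilde n : lker (Dtilde F n) == 0%VS.
Proof.
apply: lker_monop => [p ltpn|c sum0].
  by apply: leq_trans (size_scale_leq _ _) _; rewrite size_polyXn.
apply: (@triangular_free F n c (fun p => p.+1%:R%:P)).
  by move=> q _; rewrite coefC pnatr_eq0.
by rewrite -[RHS]sum0; apply: eq_bigr => q _; rewrite mulrC mul_polyC.
Qed.

End Bijectivity.

(* Main.v *)
(** Writing [y = x / (1 + x)], one has [Utilde f = (1 - y)^(n+1) / n! * \sum_m (m + 1) f(m + 1) y^m]
    and [dy/dx = (1 - y)^2], whence
    [Dtilde^-1 (Vtilde (Utilde f)) = 1 / (n! x) * \sum_(m >= 1) f(m) y^m].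
    This operator sends [n! * binom(X - 1, k)] to [x^k], because
    [\sum_m binom(m - 1, k) y^m = (y / (1 - y))^(k+1)].  It therefore conjugates the
    shift by [c] to [Bop n c], by the Chu-Vandermonde expansion of [binom(X + c - 1, k)]. *)
Require Import Defs.
From HB Require Import structures.
From mathcomp Require Import all_boot all_order all_algebra.
From mathcomp Require Import reals complex.
From mathcomp Require Import ring zify.

Set Implicit Arguments.
Unset Strict Implicit.
Unset Printing Implicit Defensive.

Import Order.TTheory GRing.Theory Num.Theory.
Local Open Scope ring_scope.

(** * Falling factorials and the Chu-Vandermonde identity *)

Section FallingFactorial.
Variable A : comNzRingType.

Definition falling (x : A) (k : nat) : A := \prod_(i < k) (x - i%:R).

Lemma fallingS x k : falling x k.+1 = falling x k * (x - k%:R).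
Proof. by rewrite /falling big_ord_recr. Qed.

Lemma falling_nat (m k : nat) : falling m%:R k = (m ^_ k)%:R.
Proof.
elim: k => [|k IHk]; first by rewrite /falling big_ord0 ffactn0.
rewrite fallingS IHk ffactnSr natrM; have [ltmk|lekm] := ltnP m k.
  by rewrite ffact_small // !mul0r.
by rewrite natrB.
Qed.

(** Induction on [k]: the new factor splits as [x + y - k = (x - i) + (y - (k - i))], and Pascal's
    rule recombines the two resulting sums. *)
Lemma falling_Vandermonde (x y : A) k :
  falling (x + y) k =
  \sum_(i < k.+1) 'C(k, i)%:R * (falling x i * falling y (k - i)).
Proof.
elim: k => [|k IHk].
  by rewrite big_ord1 /falling subnn !big_ord0 !mulr1.
rewrite fallingS IHk mulr_suml.
transitivity
  (\sum_(i < k.+1) ('C(k, i)%:R * (falling x i.+1 * falling y (k - i)) +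
     'C(k, i)%:R * (falling x i * falling y (k - i).+1))).
  apply: eq_bigr => i _; have leik : (i <= k)%N by rewrite -ltnS.
  have -> : k%:R = i%:R + (k - i)%:R :> A by rewrite -natrD subnKC.
  by rewrite !fallingS; ring.
rewrite big_split /= [RHS]big_ord_recl /= bin0 subn0.
under [X in _ = _ + X]eq_bigr => i _ do
  rewrite /bump /= add1n binS natrD mulrDl subSS.
rewrite big_split addrA [RHS]addrC; congr (_ + _).
rewrite [LHS]big_ord_recl /= bin0 subn0; congr (_ + _).
rewrite [RHS]big_ord_recr /= bin_small // mul0r addr0.
by apply: eq_bigr => i _; rewrite /bump /= add1n -subSn // subSS.
Qed.

End FallingFactorial.

(** * Power series identities as congruences modulo ['X^N] *)

Section TruncatedSeries.
Variable F : fieldType.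

(** Divisibility of a difference by ['X^N] stands for equality of power series up to order [N]. *)
Lemma dvdp_XnP N (p : {poly F}) :
  reflect (forall i, (i < N)%N -> p`_i = 0) ('X^N %| p).
Proof.
apply: (iffP idP) => [/dvdpP[q ->] i ltiN|p0]; first by rewrite coefMXn ltiN.
rewrite -[p](poly_take_drop N) dvdp_add ?dvdp_mulIr //.
suff -> : take_poly N p = 0 by rewrite dvdp0.
by apply/polyP => i; rewrite coef_take_poly coef0; case: ifP => // /p0.
Qed.

Lemma eqp_mod_Xn N (p q : {poly F}) :
  (size p <= N)%N -> (size q <= N)%N -> 'X^N %| p - q -> p = q.
Proof.
move=> sp sq /dvdp_XnP pq; apply/polyP => i; have [ltiN|leNi] := ltnP i N.
  by apply/eqP; rewrite -subr_eq0 -coefB pq.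
by rewrite !nth_default // (leq_trans _ leNi).
Qed.

(** Truncated form of [\sum_m binom(m, k) x^m = x^k / (1 - x)^(k+1)]. *)
Lemma binomial_series k N :
  'X^N %| (1 - 'X) ^+ k.+1 * \poly_(m < N) 'C(m, k)%:R - ('X^k : {poly F}).
Proof.
elim: k => [|k IHk].
  apply/dvdp_XnP => i ltiN; rewrite expr1 mulrBl mul1r !coefB coefXM !coef_poly.
  rewrite ltiN coef1 bin0; case: i ltiN => [|i] ltiN /=; first by rewrite subr0 subrr.
  by rewrite (ltnW ltiN) bin0 !subrr.
set P := \poly_(m < N) _ in IHk; set Q := \poly_(m < N) _.
(* Pascal's rule makes [(1 - 'X) * Q - 'X * P] vanish below degree [N]; the other summand is the
   induction hypothesis. *)
have -> : (1 - 'X) ^+ k.+2 * Q - ('X^(k.+1) : {poly F}) =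
  (1 - 'X) ^+ k.+1 * ((1 - 'X) * Q - 'X * P) + 'X * ((1 - 'X) ^+ k.+1 * P - 'X^k).
  by rewrite !exprS; ring.
apply: dvdp_add; apply: dvdp_mull => //.
apply/dvdp_XnP => i ltiN; rewrite mulrBl mul1r !coefB !coefXM !coef_poly ltiN.
case: i ltiN => [|i] ltiN /=; first by rewrite bin0n !subr0.
by rewrite (ltnW ltiN) binS natrD; ring.
Qed.

(** The factors [(1 - 'X) ^+ (n - 1 - p)] bring the series of the Euler polynomials, with
    denominators [(1 - x)^(p+2)], to the common denominator [(1 - x)^(n+1)]; the powers [m^(p+1)]
    then assemble into [m f(m)]. *)
Lemma sum_euler_series n N (f : {poly F}) : (size f <= n)%N ->
  'X^N %| \sum_(p < n) f`_p *: ((1 - 'X) ^+ (n - 1 - p) * euler_rec F p.+1)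
           - (1 - 'X) ^+ n.+1 * \poly_(m < N) (m%:R * f.[m%:R]).
Proof.
move=> sf.
have -> : \poly_(m < N) (m%:R * f.[m%:R]) =
    \sum_(p < n) f`_p *: \poly_(m < N) (m ^ p.+1)%:R.
  apply/polyP => i; rewrite coef_poly coef_sum; case: ltnP => ltiN.
    rewrite (horner_coef_wide _ sf) mulr_sumr; apply: eq_bigr => p _.
    by rewrite coefZ coef_poly ltiN expnS natrM natrX mulrCA.
  by rewrite big1 // => p _; rewrite coefZ coef_poly ltnNge ltiN mulr0.
rewrite mulr_sumr -sumrB.
apply: (big_ind (fun q => 'X^N %| q)) => [|p q|p _]; first exact: dvdp0.
  exact: dvdp_add.
have -> : n.+1 = (n - 1 - p + p.+2)%N by have := ltn_ord p; lia.
rewrite -scalerAr -scalerBr exprD -mulrA -mulrBr -mul_polyC.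
apply/dvdp_mull/dvdp_mull/dvdp_XnP => i; exact: coef_euler_rec_trunc.
Qed.

End TruncatedSeries.

(** * The binomial basis and the conjugation of the shift *)

Section Conjugation.
Variable F : numFieldType.

(** This is [binom(X - 1, k)]; the offset 1 absorbs the extra factor [m] in the series of
    [sum_euler_series]. *)
Definition binom_poly (k : nat) : {poly F} := k`!%:R^-1 *: falling ('X - 1) k.

Lemma natr_fact_neq0 k : k`!%:R != 0 :> F.
Proof. by rewrite pnatr_eq0 -lt0n fact_gt0. Qed.

Lemma size_binom_poly k : (size (binom_poly k) <= k.+1)%N.
Proof.
apply: leq_trans (size_scale_leq _ _) _.
elim: k => [|k IHk]; first by rewrite /falling big_ord0 size_poly1.
rewrite fallingS; apply: leq_trans (size_polyMleq _ _) _.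
by rewrite -addrA -opprD nat1r -polyC_natr size_XsubC addn2 ltnS.
Qed.

Lemma binom_poly_nat k m :
  m%:R * (binom_poly k).[m%:R] = (k.+1 * 'C(m, k.+1))%:R.
Proof.
apply: (mulfI (natr_fact_neq0 k)).
rewrite /binom_poly hornerZ mulrCA mulVKf ?natr_fact_neq0 //.
rewrite -natrM mulnA [(_ * k.+1)%N]mulnC -factS mulnC bin_ffact -falling_nat.
(* The factor of index 0 is [m] itself; the remaining ones are those of [falling (m - 1) k], which
   also covers [m = 0]. *)
rewrite /falling big_ord_recl subr0 horner_prod; congr (_ * _).
apply: eq_bigr => i _; rewrite -polyC_natr !hornerE -addrA -opprD.
by rewrite nat1r.
Qed.

(** Chu-Vandermonde for [(X - 1) + c], where [binom(k, i) / k! = 1 / (i! (k - i)!)] distributes the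
    factorials. *)
Lemma binom_poly_shift c k :
  binom_poly k \Po ('X + c%:P) =
  \sum_(i < k.+1) gbinom c (k - i) *: binom_poly i.
Proof.
have -> : binom_poly k \Po ('X + c%:P) =
    k`!%:R^-1 *: falling (('X - 1) + c%:P) k.
  rewrite comp_polyZ /falling rmorph_prod /=; congr (_ *: _).
  apply: eq_bigr => i _; rewrite -polyC_natr -polyC1 !comp_polyB.
  by rewrite comp_polyX !comp_polyC; ring.
rewrite falling_Vandermonde scaler_sumr; apply: eq_bigr => i _.
have -> : falling (c%:P : {poly F}) (k - i) = (\prod_(j < k - i) (c - j%:R))%:P.
  rewrite rmorph_prod; apply: eq_bigr => j _ /=.
  by rewrite polyCB polyC_natr.
rewrite /gbinom /binom_poly -polyC_natr -!mul_polyC.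
have leik : (i <= k)%N by rewrite -ltnS.
rewrite -(bin_fact leik) !natrM !polyCM.
have -> : ((('C(k, i)%:R * (i`!%:R * (k - i)`!%:R))^-1)%:P : {poly F}) =
   (('C(k, i)%:R)^-1)%:P * ((i`!%:R)^-1)%:P * (((k - i)`!%:R)^-1)%:P.
  by rewrite !invfM !polyCM mulrA.
have bC : ((('C(k, i)%:R)^-1)%:P * ('C(k, i)%:R)%:P : {poly F}) = 1.
  by rewrite -polyCM mulVf // pnatr_eq0 -lt0n bin_gt0.
(* With inverses named as atoms, [ring] only has to permute factors; [bC] is the one relation used
   between them. *)
set u := (_^-1)%:P in bC *; set v := (_%:R)%:P in bC *.
set a := (_^-1)%:P; set b := (_^-1)%:P; set p := (\prod_(_ < _) _)%:P.
set q := falling _ _.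
transitivity (u * v * (a * b * q * p)); first by ring.
by rewrite bC mul1r; ring.
Qed.

(** Candidate inverse of [Dtilde^-1 Vtilde Utilde]; the factor [n!] cancels the one in [Utilde]. *)
Definition binom_op n : 'End({poly_n F}) :=
  monop n (fun k => n`!%:R *: binom_poly k).

Lemma size_scaled_binom_poly n k : (k < n)%N -> (size (n`!%:R *: binom_poly k) <= n)%N.
Proof.
move=> ltkn; apply: leq_trans (size_scale_leq _ _) _.
exact: leq_trans (size_binom_poly k) ltkn.
Qed.

Lemma size_one_subX_exp j : (size ((1 - 'X : {poly F}) ^+ j) <= j.+1)%N.
Proof.
apply: leq_trans (size_poly_exp_leq _ _) _.
by rewrite -opprB size_polyN size_XsubC mul1n.
Qed.

Lemma size_XnM_one_subX_exp k j :
  (size ('X^k * (1 - 'X) ^+ j : {poly F})%R <= (k + j).+1)%N.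
Proof.
apply: leq_trans (size_polyMleq _ _) _; rewrite size_polyXn addSn /= -addnS.
by rewrite leq_add2l size_one_subX_exp.
Qed.

Lemma size_Utilde_monomial n p : (p < n)%N ->
  (size (n`!%:R^-1 *: ((1 - 'X) ^+ (n - 1 - p) * euler_tilde F p.+1)) <= n)%N.
Proof.
move=> ltpn; apply: leq_trans (size_scale_leq _ _) _.
apply: leq_trans (size_polyMleq _ _) _.
have h2 := size_euler_tilde F (ltn0Sn p).
have h1 := size_one_subX_exp (n - 1 - p).
rewrite -subn1 leq_subLR; apply: leq_trans (leq_add h1 h2) _; lia.
Qed.

Lemma Utilde_binom_op n k : (k < n)%N ->
  Utilde F n (binom_op n (npolyp n 'X^k)) =
  k.+1%:R *: ('X^k * (1 - 'X) ^+ (n - 1 - k)) :> {poly F}.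
Proof.
move=> ltkn; set f := binom_op n _.
have fE : f = n`!%:R *: binom_poly k :> {poly F}.
  by rewrite monopX // size_scaled_binom_poly.
have sf : (size f <= n)%N by apply: size_npoly.
have sU : (size (Utilde F n f) <= n)%N by apply: size_npoly.
have nzX : 'X != 0 :> {poly F} by rewrite polyX_eq0.
(* Multiplication by ['X] turns [euler_tilde] into the Euler polynomial. Both sides then have degree
   at most [n], so a congruence modulo ['X^(n.+1)] suffices. *)
apply: (mulIf nzX); apply: (@eqp_mod_Xn F n.+1).
- by apply: leq_trans (size_polyMleq _ _) _; rewrite size_polyX addn2 ltnS.
- rewrite -scalerAl; apply: leq_trans (size_scale_leq _ _) _.
  rewrite mulrAC -exprSr.
  by apply: leq_trans (size_XnM_one_subX_exp _ _) _; lia.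
have -> : polyn (Utilde F n f) * 'X = n`!%:R^-1 *:
    \sum_(p < n) f`_p *: ((1 - 'X) ^+ (n - 1 - p) * euler_rec F p.+1).
  rewrite monopE; last exact: size_Utilde_monomial.
  rewrite mulr_suml scaler_sumr; apply: eq_bigr => p _.
  by rewrite -!scalerAl -mulrA euler_tildeK // euler_polyE scalerA mulrC -scalerA.
have := sum_euler_series n.+1 sf.
set S := \sum_(p < n) _.
have -> : \poly_(m < n.+1) (m%:R * f.[m%:R]) =
   (n`!%:R * k.+1%:R) *: \poly_(m < n.+1) 'C(m, k.+1)%:R :> {poly F}.
  apply/polyP => i; rewrite coefZ !coef_poly; case: ifP => _; last by rewrite mulr0.
  by rewrite fE hornerZ mulrCA binom_poly_nat natrM mulrA.
set P := \poly_(m < n.+1) _ => dS.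
have dP := binomial_series F k.+1 n.+1; rewrite -/P in dP.
(* The difference is split into the error of the Euler series and that of the binomial series; the
   terms in [P] cancel. *)
have -> : n`!%:R^-1 *: S - k.+1%:R *: ('X^k * (1 - 'X) ^+ (n - 1 - k)) * 'X =
   n`!%:R^-1 *: (S - (1 - 'X) ^+ n.+1 * ((n`!%:R * k.+1%:R) *: P)) +
   (k.+1%:R *: (1 - 'X) ^+ (n - 1 - k)) * ((1 - 'X) ^+ k.+2 * P - 'X^(k.+1)).
  have {1}-> : n.+1 = (n - 1 - k + k.+2)%N by lia.
  rewrite scalerBr -scalerAr scalerA mulKf ?natr_fact_neq0 // -!scalerAl mulrBr scalerBr.
  by rewrite exprD -(mulrA _ _ P) addrA subrK mulrAC -exprSr [_ * 'X^_]mulrC.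
by apply: dvdp_add; [rewrite dvdpZr ?invr_eq0 ?natr_fact_neq0 | exact: dvdp_mull].
Qed.

Lemma eq_End_monomials n (f g : 'End({poly_n F})) :
  (forall k, (k < n)%N -> f (npolyp n 'X^k) = g (npolyp n 'X^k)) -> f = g.
Proof.
move=> fg; apply/lfunP => u.
have -> : u = \sum_(k < n) u`_k *: npolyp n 'X^k.
  apply/npolyP => i; rewrite raddf_sum /= coef_sum.
  have [ltin|leni] := ltnP i n.
    rewrite (bigD1 (Ordinal ltin)) //= big1 ?addr0.
      by rewrite coefZ coef_npolyp ltin coefXn eqxx mulr1.
    move=> j; rewrite -val_eqE /= => /negPf nij.
    by rewrite coefZ coef_npolyp ltin coefXn eq_sym nij mulr0.
  rewrite big_coef_npoly // big1 // => j _.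
  by rewrite coefZ coef_npolyp ltnNge leni mulr0.
by rewrite !linear_sum; apply: eq_bigr => k _; rewrite !linearZ /= fg.
Qed.

Lemma npolypB n (p q : {poly F}) : npolyp n (p - q) = npolyp n p - npolyp n q.
Proof.
apply/npolyP => i; rewrite coefB !coef_npolyp coefB.
by case: ifP; rewrite ?subr0.
Qed.

(** [Vtilde] is [f(x) |-> (1 + x)^(n-1) f(x / (1 + x))], and [1 - x / (1 + x) = 1 / (1 + x)]. The
    induction on [j] uses only [(1 + x) - x = 1]. *)
Lemma Vtilde_one_subX_exp n k j : (k + j < n)%N ->
  Vtilde F n (npolyp n ('X^k * (1 - 'X) ^+ j)) =
  'X^k * (1 + 'X) ^+ (n - 1 - (k + j)) :> {poly F}.
Proof.
elim: j k => [|j IHj] k ltkjn.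
  rewrite addn0 in ltkjn *; rewrite expr0 mulr1 monopX //; last first.
    have s1X : (size ((1 + 'X : {poly F}) ^+ (n - k - 1)) <= (n - k - 1).+1)%N.
      apply: leq_trans (size_poly_exp_leq _ _) _.
      by rewrite addrC size_XaddC mul1n.
    apply: leq_trans (size_polyMleq _ _) _; rewrite size_polyXn addnS /=.
    by apply: leq_trans (leq_add s1X (leqnn k)) _; lia.
  by rewrite mulrC subnAC.
have -> : 'X^k * (1 - 'X) ^+ j.+1 =
    'X^k * (1 - 'X) ^+ j - 'X^(k.+1) * (1 - 'X) ^+ j :> {poly F}.
  by rewrite !exprS; ring.
rewrite npolypB linearB /= !IHj; [|by lia..].
have -> : (n - 1 - (k + j) = (n - 1 - (k + j.+1)).+1)%N by lia.
by rewrite addSnnS !exprS; ring.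
Qed.

(** With [j = n - 1 - k] no power of [1 + 'X] survives in [Vtilde_one_subX_exp], leaving
    [(k + 1) x^k]. *)
Lemma Vtilde_Utilde_binom_op n :
  (Vtilde F n \o Utilde F n \o binom_op n)%VF = Dtilde F n.
Proof.
apply: eq_End_monomials => k ltkn; rewrite !comp_lfunE.
have -> : Utilde F n (binom_op n (npolyp n 'X^k)) =
    k.+1%:R *: npolyp n ('X^k * (1 - 'X) ^+ (n - 1 - k)).
  apply/val_inj; rewrite /= Utilde_binom_op // npolypK //.
  by apply: leq_trans (size_XnM_one_subX_exp _ _) _; lia.
apply/val_inj; rewrite linearZ /= Vtilde_one_subX_exp; last by lia.
rewrite monopX //; first by rewrite subnKC ?subnn ?mulr1 //; lia.
by apply: leq_trans (size_scale_leq _ _) _; rewrite size_polyXn.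
Qed.

(** The coefficients of [Bop n c] are exactly those of the shifted binomial basis in
    [binom_poly_shift]. *)
Lemma shiftop_binom_op n c :
  (shiftop n c \o binom_op n)%VF = (binom_op n \o Bop n c)%VF.
Proof.
apply: eq_End_monomials => k ltkn; rewrite !comp_lfunE.
have -> : Bop n c (npolyp n 'X^k) =
    \sum_(i < k.+1) gbinom c (k - i) *: npolyp n 'X^i.
  apply/val_inj; rewrite /= monopX //.
    rewrite raddf_sum; apply: eq_bigr => i _ /=.
    by rewrite npolypK // size_polyXn; have := ltn_ord i; lia.
  apply: leq_trans (size_sum _ _ _) _; apply/bigmax_leqP => i _.
  apply: leq_trans (size_scale_leq _ _) _.
  by rewrite size_polyXn; have := ltn_ord i; lia.
apply/val_inj; rewrite /= shiftopE monopX ?size_scaled_binom_poly //.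
rewrite comp_polyZ binom_poly_shift scaler_sumr linear_sum raddf_sum.
apply: eq_bigr => i _; have ltin : (i < n)%N by have := ltn_ord i; lia.
rewrite [X in _ = polyn X]linearZ /= monopX ?size_scaled_binom_poly //.
by rewrite !scalerA [_ * n`!%:R]mulrC.
Qed.

Lemma shiftop_conjugate n c :
  (Utilde F n \o shiftop n c \o (Utilde F n)^-1)%VF =
  ((Vtilde F n)^-1 \o Dtilde F n \o Bop n c \o (Dtilde F n)^-1 \o Vtilde F n)%VF.
Proof.
have VUT := Vtilde_Utilde_binom_op n; have ST := shiftop_binom_op n c.
have kU := lker_Utilde F n; have kV := lker_Vtilde F n; have kD := lker_Dtilde F n.
set U := Utilde F n in VUT kU *; set V := Vtilde F n in VUT kV *.
set D := Dtilde F n in VUT kD *; set T := binom_op n in VUT ST.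
have UT : (U \o T = V^-1 \o D)%VF by rewrite -VUT -comp_lfunA lker0_compKf.
(* Indeed [U T D^-1 V = V^-1 D D^-1 V = 1]; then [U S U^-1 = U S T D^-1 V = U T B D^-1 V] for the
   shift [S] and [B = Bop n c]. *)
have Uinv : (U^-1 = T \o D^-1 \o V)%VF.
  rewrite -[RHS](lker0_compKf kU) !comp_lfunA -(comp_lfunA _ U) UT.
  by rewrite comp_lfunA lker0_compfK // lker0_compfVK.
by rewrite Uinv !comp_lfunA -(comp_lfunA U _ T) ST comp_lfunA UT.
Qed.

End Conjugation.

Theorem theorem4 (R : realType) (n : nat) (hn : (1 <= n)%N) (beta : R[i]) :
  Aop n beta
  = ((Vtilde R[i] n)^-1 \o Dtilde R[i] n \o Bop n (n%:R * beta)
       \o (Dtilde R[i] n)^-1 \o Vtilde R[i] n)%VF.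
Proof. exact: shiftop_conjugate. Qed.
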